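(* Let $F$ be an algebraically closed field of characteristic $0$, let $n\ge2$, $\Omega=\{1,\dots,n\}$, and let $\mathfrak{A}$ be the universal associative envelope of the anti-Jordan triple system of all $n\times n$ matrices over $F$, with generators $e_{i,j}$. For all $i,j\in\Omega$ the following identities hold in $\mathfrak{A}$. (1) $e_{1,1}^4\cdot e_{i,j}=\delta_{i,1}\big(\delta_{j,1}e_{1,1}+\widehat\delta_{j,1}e_{1,1}^2e_{1,j}\big)-\widehat\delta_{i,1}\delta_{j,1}e_{1,1}^2e_{i,1}.$ (2) If $(i,j)\ne(1,1)$: $\;e_{1,1}^4\cdot e_{1,i}e_{j,1}=\delta_{i,1}e_{1,1}e_{j,1}+\widehat\delta_{i,1}\widehat\delta_{j,1}\delta_{i,j}\tfrac12(e_{1,1}^4+e_{1,1}^2).$ (3) $e_{1,1}^4\cdot e_{i,1}e_{1,j}=\delta_{i,1}e_{1,1}e_{1,j}+\widehat\delta_{i,1}\delta_{i,j}\tfrac12(e_{1,1}^2-e_{1,1}^4).$ (4) $e_{1,1}^4\cdot e_{1,1}^2e_{1,j}=e_{1,1}^2e_{1,j}.$ (5) If $j\ne1$: $\;e_{1,1}^4\cdot e_{1,i}e_{1,1}e_{j,1}=\delta_{i,1}e_{1,1}^2e_{j,1}.$ (6) $e_{1,1}^4\cdot e_{1,1}^4=e_{1,1}^4.$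
   Context: $\delta_{i,j}$ is the Kronecker delta and $\widehat\delta_{i,j}=1-\delta_{i,j}$. The anti-Jordan triple system of all $n\times n$ matrices over $F$ has trilinear product $\langle a,b,c\rangle=abc-cba$. Its universal associative envelope is $\mathfrak{A}=F\langle X\rangle/I$, where $F\langle X\rangle$ is the free unital associative algebra on symbols $X=\{e_{i,j}\}_{i,j\in\Omega}$ (with $e_{i,j}$ corresponding to the matrix unit $E_{i,j}$), and $I$ is the two-sided ideal generated by all elements $e_{i,j}e_{k,\ell}e_{m,t}-e_{m,t}e_{k,\ell}e_{i,j}-\delta_{j,k}\delta_{\ell,m}e_{i,t}+\delta_{t,k}\delta_{\ell,i}e_{m,j}$ for $i,j,k,\ell,m,t\in\Omega$. The image of $e_{i,j}$ in $\mathfrak{A}$ is again denoted $e_{i,j}$. *)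

(* Defs.v *)
From HB Require Import structures.
From mathcomp Require Import all_boot all_order all_algebra.
From mathcomp Require Import boolp.
From mathcomp.multinomials Require Import monalg.

Set Implicit Arguments.
Unset Strict Implicit.
Unset Printing Implicit Defensive.

Import GRing.Theory.
Local Open Scope ring_scope.
Local Open Scope quotient_scope.

Definition kd (R : nzRingType) (T : eqType) (i j : T) : R := (i == j)%:R.
Definition kdhat (R : nzRingType) (T : eqType) (i j : T) : R := 1 - kd R i j.

Definition ajtriple (R : nzRingType) (a b c : R) : R := a * b * c - c * b * a.

Inductive two_sided_ideal (R : nzRingType) (S : R -> Prop) : R -> Prop :=
| ideal_gen x : S x -> two_sided_ideal S x
| ideal_zero : two_sided_ideal S 0
| ideal_add x y :
    two_sided_ideal S x -> two_sided_ideal S y -> two_sided_ideal S (x + y)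
| ideal_mull a x : two_sided_ideal S x -> two_sided_ideal S (a * x)
| ideal_mulr a x : two_sided_ideal S x -> two_sided_ideal S (x * a).

Section Envelope.
Variables (F : fieldType) (n : nat).

(* The monoid algebra over the free monoid of words in the letters (i, j),
   i.e., the free unital associative algebra on the symbols e_{i,j}. *)
Definition free_alg := {malg F[{fmonom ('I_n * 'I_n)%type}]}.
HB.instance Definition _ := GRing.Lalgebra.on free_alg.

Definition gen (i j : 'I_n) : free_alg := << fmu (i, j) >>.

Definition relator (i j k l m t : 'I_n) : free_alg :=
  gen i j * gen k l * gen m t - gen m t * gen k l * gen i j
  - (kd F j k * kd F l m) *: gen i t + (kd F t k * kd F l i) *: gen m j.

Definition env_relation (x : free_alg) : Prop :=
  exists i j k l m t, x = relator i j k l m t.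

Definition env_ideal : {pred free_alg} :=
  fun x => `[< two_sided_ideal env_relation x >].

Lemma env_idealP x : reflect (two_sided_ideal env_relation x) (x \in env_ideal).
Proof. exact: asboolP. Qed.

Lemma env_ideal_zmod_closed : zmod_closed env_ideal.
Proof.
split=> [|x y /env_idealP xI /env_idealP yI]; apply/env_idealP.
  exact: ideal_zero.
by rewrite -mulN1r; apply: ideal_add => //; apply: ideal_mull.
Qed.
HB.instance Definition _ :=
  GRing.isZmodClosed.Build free_alg env_ideal env_ideal_zmod_closed.

Lemma env_idealMl a x : x \in env_ideal -> a * x \in env_ideal.
Proof. by move=> /env_idealP xI; apply/env_idealP/ideal_mull. Qed.

Lemma env_idealMr a x : x \in env_ideal -> x * a \in env_ideal.
Proof. by move=> /env_idealP xI; apply/env_idealP/ideal_mulr. Qed.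

(* The augmentation (constant coefficient) vanishes on the ideal. *)
Lemma mcoeff1_gen i j : mcoeff (@mone _) (gen i j) = 0.
Proof. by rewrite /gen mcoeffU1 -val_eqE /= fmU fm1. Qed.

Lemma env_ideal_mcoeff1 x : x \in env_ideal -> mcoeff (@mone _) x = 0.
Proof.
move=> /env_idealP; elim=> {x} [x [i [j [k [l [m [t ->]]]]]]||x y _ IHx _ IHy
  |a x _ IHx|a x _ IHx].
- have rel0 (A : nzRingType) (f : {rmorphism A -> F}) a b c u v :
      f a = 0 -> f c = 0 -> f u = 0 -> f v = 0 ->
      f (a * b * c - c * b * a - u + v) = 0.
    move=> fa fc fu fv; rewrite rmorphD !rmorphB !rmorphM /= fa fc fu fv.
    by rewrite !mulr0 !subr0 addr0.
  apply: rel0; first [exact: mcoeff1_gen | by rewrite /= mcoeffZ mcoeff1_gen mulr0].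
- exact: mcoeff0.
- by rewrite mcoeffD IHx IHy addr0.
- by rewrite rmorphM /= IHx mulr0.
- by rewrite rmorphM /= IHx mul0r.
Qed.

Lemma one_notin_env_ideal : 1 \notin env_ideal.
Proof.
by apply/negP => /env_ideal_mcoeff1/eqP; rewrite rmorph1 oner_eq0.
Qed.

Lemma free_alg_scalerAr (c : F) (x y : free_alg) : c *: (x * y) = x * (c *: y).
Proof.
rewrite -[RHS]mul1r -[in RHS]mul_malgC.
suff xC: x * c%:MP = c%:MP * x by rewrite mul1r mulrA xC -mulrA mul_malgC.
rewrite [LHS]fgmulgU [RHS]fgmulUg; apply: eq_bigr => k _.
by rewrite mulm1 mul1m mulrC.
Qed.

Definition envelope := Quotient.quot env_ideal.
HB.instance Definition _ := GRing.Zmodule.on envelope.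
HB.instance Definition _ := EqQuotient.on envelope.

Definition env_proj (x : free_alg) : envelope := \pi_envelope x.

Lemma env_proj_eq x y : (env_proj x == env_proj y) = (x - y \in env_ideal).
Proof. by rewrite Quotient.idealrBE. Qed.

Lemma env_proj_surj (u : envelope) : exists x, u = env_proj x.
Proof. by exists (repr u); rewrite /env_proj reprK. Qed.

Lemma env_projD : {morph env_proj : x y / x + y}.
Proof. by move=> x y; rewrite /env_proj !piE. Qed.

Definition env_one : envelope := env_proj 1.
Definition env_mul (u v : envelope) : envelope := env_proj (repr u * repr v).
Definition env_scale (c : F) (u : envelope) : envelope :=
  env_proj (c *: repr u).

Lemma repr_env_proj x : repr (env_proj x) - x \in env_ideal.
Proof. by rewrite -env_proj_eq /env_proj reprK. Qed.

Lemma env_projM x y : env_proj (x * y) = env_mul (env_proj x) (env_proj y).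
Proof.
apply/esym/eqP; rewrite env_proj_eq.
set x' := repr _; set y' := repr _.
have -> : x' * y' - x * y = x' * (y' - y) + (x' - x) * y.
  by rewrite mulrBr mulrBl addrA subrK.
by apply: rpredD; [apply: env_idealMl|apply: env_idealMr]; exact: repr_env_proj.
Qed.

Lemma env_projZ c x : env_proj (c *: x) = env_scale c (env_proj x).
Proof.
apply/esym/eqP; rewrite env_proj_eq -scalerBr -mul_malgC.
by rewrite env_idealMl // repr_env_proj.
Qed.

Let envE := (env_projM, env_projZ, env_projD).

Lemma env_mulA : associative env_mul.
Proof.
move=> u v w; have [x ->] := env_proj_surj u; have [y ->] := env_proj_surj v.
by have [z ->] := env_proj_surj w; rewrite -!envE mulrA.
Qed.

Lemma env_mul1l : left_id env_one env_mul.
Proof. by move=> u; have [x ->] := env_proj_surj u; rewrite -!envE mul1r. Qed.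

Lemma env_mulr1 : right_id env_one env_mul.
Proof. by move=> u; have [x ->] := env_proj_surj u; rewrite -!envE mulr1. Qed.

Lemma env_mulDl : left_distributive env_mul +%R.
Proof.
move=> u v w; have [x ->] := env_proj_surj u; have [y ->] := env_proj_surj v.
by have [z ->] := env_proj_surj w; rewrite -!envE mulrDl.
Qed.

Lemma env_mulDr : right_distributive env_mul +%R.
Proof.
move=> u v w; have [x ->] := env_proj_surj u; have [y ->] := env_proj_surj v.
by have [z ->] := env_proj_surj w; rewrite -!envE mulrDr.
Qed.

Lemma env_oner_neq0 : env_one != 0.
Proof.
have -> : 0 = env_proj 0 by rewrite /env_proj !piE.
by rewrite env_proj_eq subr0 one_notin_env_ideal.
Qed.

HB.instance Definition _ := GRing.Zmodule_isNzRing.Build envelope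
  env_mulA env_mul1l env_mulr1 env_mulDl env_mulDr env_oner_neq0.

Lemma env_scaleA c d u : env_scale c (env_scale d u) = env_scale (c * d) u.
Proof. by have [x ->] := env_proj_surj u; rewrite -!envE scalerA. Qed.

Lemma env_scale1 : left_id 1 env_scale.
Proof. by move=> u; have [x ->] := env_proj_surj u; rewrite -!envE scale1r. Qed.

Lemma env_scaleDr : right_distributive env_scale +%R.
Proof.
move=> c u v; have [x ->] := env_proj_surj u; have [y ->] := env_proj_surj v.
by rewrite -!envE scalerDr.
Qed.

Lemma env_scaleDl u : {morph env_scale^~ u : c d / c + d}.
Proof. by move=> c d; have [x ->] := env_proj_surj u; rewrite -!envE scalerDl. Qed.

HB.instance Definition _ := GRing.Zmodule_isLmodule.Build F envelope
  env_scaleA env_scale1 env_scaleDr env_scaleDl.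

Lemma env_scaleAl (c : F) (u v : envelope) : c *: (u * v) = (c *: u) * v.
Proof.
have [x ->] := env_proj_surj u; have [y ->] := env_proj_surj v.
by rewrite /GRing.scale /GRing.mul /= -!envE scalerAl.
Qed.

HB.instance Definition _ := GRing.Lmodule_isLalgebra.Build F envelope env_scaleAl.

Lemma env_scaleAr (c : F) (u v : envelope) : c *: (u * v) = u * (c *: v).
Proof.
have [x ->] := env_proj_surj u; have [y ->] := env_proj_surj v.
by rewrite /GRing.scale /GRing.mul /= -!envE free_alg_scalerAr.
Qed.

HB.instance Definition _ := GRing.Lalgebra_isAlgebra.Build F envelope env_scaleAr.

Lemma env_proj_is_zmod_morphism : zmod_morphism env_proj.
Proof. by move=> x y; rewrite /env_proj !piE. Qed.
HB.instance Definition _ := GRing.isZmodMorphism.Build free_alg envelope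
  env_proj env_proj_is_zmod_morphism.

Lemma env_proj_is_monoid_morphism : monoid_morphism env_proj.
Proof. by split=> // x y; rewrite env_projM. Qed.
HB.instance Definition _ := GRing.isMonoidMorphism.Build free_alg envelope
  env_proj env_proj_is_monoid_morphism.

Lemma env_proj_is_scalable : scalable env_proj.
Proof. by move=> c x; rewrite env_projZ. Qed.
HB.instance Definition _ := GRing.isScalable.Build F free_alg envelope *:%R
  env_proj env_proj_is_scalable.

Definition env_e (i j : 'I_n) : envelope := env_proj (gen i j).

Lemma env_e_rel i j k l m t :
  env_e i j * env_e k l * env_e m t - env_e m t * env_e k l * env_e i j
  - (kd F j k * kd F l m) *: env_e i t + (kd F t k * kd F l i) *: env_e m j = 0.
Proof.
have morphE (A B : lalgType F) (f : {lrmorphism A -> B}) a b c u v x y :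
    f (a * b * c - c * b * a - x *: u + y *: v) =
    f a * f b * f c - f c * f b * f a - x *: f u + y *: f v.
  by rewrite rmorphD !rmorphB !rmorphM /= !linearZ.
rewrite -(morphE _ _ env_proj); apply/eqP.
rewrite -[X in _ == X](rmorph0 env_proj) env_proj_eq subr0.
by apply/env_idealP/ideal_gen; exists i, j, k, l, m, t.
Qed.

End Envelope.

(* The scalar terms of the relator are the coordinates of the triple product
   of matrix units. *)
Lemma ajtriple_delta (F : fieldType) (n : nat) (i j k l m t : 'I_n.+1) :
  ajtriple (delta_mx i j : 'M[F]_n.+1) (delta_mx k l) (delta_mx m t) =
  (kd F j k * kd F l m) *: delta_mx i t - (kd F t k * kd F l i) *: delta_mx m j.
Proof.
have mulE (a b c d p q : 'I_n.+1) :
    delta_mx a b *m delta_mx c d *m delta_mx p q =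
    (kd F b c * kd F d p) *: delta_mx a q :> 'M[F]_n.+1.
  rewrite mul_delta_mx_cond /kd mulrb; case: (b == c).
    by rewrite mulr1n mul_delta_mx_cond mul1r scaler_nat.
  by rewrite mul0mx mul0r scale0r.
by rewrite /ajtriple /GRing.mul /= !mulE.
Qed.

(* Main.v *)
Require Import Defs.
From mathcomp Require Import all_boot all_order all_algebra.

(** Write [a = e_pp], [b = e_pq], [c = e_qp], [d = e_qq] for two distinct
    indices [p], [q].  Two features of the relation
    [xyz - zyx = <x, y, z>] drive everything.

    First, symmetrizing it in [x] and [y] shows that the anticommutator
    [xy + yx] acts by commutators on the generators exactly as the matrix
    [xy + yx] acts on matrices ([bracket_jordan], [bracket_unit]).  So any known
    identity among the generators may be differentiated along a matrix unit
    [E_ij], [i <> j], to give another identity; in particular an anticommutator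
    whose matrix vanishes is central.

    Second, the commutator [k = bc - cb] anticommutes with [a] and [d] up to
    scalars: [ka + ak = 2a] and [kd + dk = -2d] ([jordan_bracket]).  Hence [ad]
    and [da] are eigenvectors of [ad k] for the eigenvalues [4] and [-4], whereas
    [ad + da] is killed by [ad k], its matrix being zero.  As [2] is regular,
    [ad = da = 0] ([diag_mul0]).

    Differentiating [ad = 0] along [E_pq] and [E_qp] gives [ab = bd] and
    [ac = cd], so that [aba = bda = 0] and [aca = 0].  Together with the relations
    [a^2 b = b a^2 + b] and [a^2 c = c a^2 - c] this yields [a^3 b = ab] and
    [a^3 c = - ac].  Now multiply [a = abc - cba] by [a^2], twice: this gives
    [a^3 = abc + cba] and [a^5 = abc - cba = a], and [2abc = a^3 + a] by adding.
    Likewise [a = bca - acb] leads to [2acb = a^3 - a].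

    Products involving three distinct indices are derivatives of two-index ones:
    [e_pp e_ij], [e_pp e_pi e_jp] and [e_pp e_ip e_pj] with [i <> j] are obtained,
    up to sign, by differentiating [e_pp e_jj = 0] and the formulas for [abc] and
    [acb], and they all vanish because [a] itself has derivative zero.

    In each of the six identities, [a^4] multiplies a word; one or three of the factors [a] next to that
    word are absorbed by the evaluations above, and the powers of [a] that remain
    reduce through [a^5 = a]. *)

Import GRing.Theory.
Local Open Scope ring_scope.

Set Implicit Arguments.
Unset Strict Implicit.

(** * Commutators and anticommutators *)

Definition bracket {R : nzRingType} (x y : R) := x * y - y * x.
Definition jordan {R : nzRingType} (x y : R) := x * y + y * x.

Section Bracket.
Variable R : nzRingType.
Implicit Types x y z u k : R.

Lemma bracketM u x y : bracket u (x * y) = bracket u x * y + x * bracket u y.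
Proof. by rewrite /bracket mulrBl mulrBr !mulrA subrKA. Qed.

Lemma bracketD u x y : bracket u (x + y) = bracket u x + bracket u y.
Proof. by rewrite /bracket mulrDl mulrDr opprD addrACA. Qed.

Lemma bracketN u x : bracket u (- x) = - bracket u x.
Proof. by rewrite /bracket mulrN mulNr opprB opprK addrC. Qed.

Lemma bracket0 u : bracket u 0 = 0.
Proof. by rewrite /bracket mulr0 mul0r subrr. Qed.

Lemma bracketC x y : bracket x y = - bracket y x.
Proof. by rewrite /bracket opprB. Qed.

Lemma bracketNl u x : bracket (- u) x = - bracket u x.
Proof. by rewrite bracketC bracketN [in RHS]bracketC. Qed.

(** The right-hand side is the sum of the anti-Jordan triple products of
    [x], [y], [z] and of [y], [x], [z], which turns the ternary defining
    relations into a statement about inner derivations. *)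
Lemma bracket_jordan x y z :
  bracket (jordan x y) z
  = (x * y * z - z * y * x) + (y * x * z - z * x * y).
Proof.
rewrite /bracket /jordan mulrDl mulrDr !mulrA [z * x * y + _]addrC.
by rewrite opprD addrACA.
Qed.

Lemma jordan_bracket x y z :
  jordan (bracket x y) z
  = (x * y * z - z * y * x) + (z * x * y - y * x * z).
Proof.
rewrite /bracket /jordan mulrBl mulrBr !mulrA.
by rewrite addrACA [RHS]addrACA; congr (_ + _); rewrite addrC.
Qed.

(** Moving [k] through [x] and then through [y] changes its sign twice, so
    anticommutation up to scalars becomes commutation up to a scalar. *)
Lemma jordan_eigen k x y (m n : nat) :
  jordan k x = x *+ m -> jordan k y = - (y *+ n) ->
  bracket k (x * y) = x * y *+ (m + n).
Proof.
move=> /(canRL (addrK _)) kx /(canRL (addKr _)) yk.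
rewrite /bracket mulrA kx -[x * y * k]mulrA yk.
rewrite mulrBl mulrDr !mulrN mulrA mulrnAl mulrnAr opprD !opprK mulrnDr.
by rewrite [x * k * y + _]addrC addrACA addrC addrA addNr add0r.
Qed.

End Bracket.

(** * Representations of the anti-Jordan triple system of matrices *)

Section Representation.
Variables (R : nzRingType) (I : eqType) (e : I -> I -> R).
Hypothesis two_regular : forall x : R, x *+ 2 = 0 -> x = 0.
Hypothesis e_rel : forall i j k l m t,
  e i j * e k l * e m t - e m t * e k l * e i j
  = e i t *+ ((j == k) && (l == m)) - e m j *+ ((t == k) && (l == i)).

(** As matrices, [E_ii E_ij + E_ij E_ii = E_ij]: this anticommutator
    realizes the derivation [ad E_ij] on the generators. *)
Lemma bracket_unit i j k l : i != j ->
  bracket (jordan (e i i) (e i j)) (e k l)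
  = e i l *+ (j == k) - e k j *+ (l == i).
Proof.
move=> /negPf ij; rewrite bracket_jordan !e_rel eqxx.
rewrite [j == i]eq_sym ij /= !andbF !andbT.
by rewrite !mulr0n subr0 sub0r.
Qed.

Section TwoIndices.
Variables p q : I.
Hypothesis pq : p != q.

Let qp : q != p. Proof. by rewrite eq_sym. Qed.
Let relE := (eqxx, negPf pq, negPf qp,
  andbT, andbF, mulr0n, mulr1n, subr0, sub0r, addr0, add0r).

Lemma jordan_weight_left :
  jordan (bracket (e p q) (e q p)) (e p p) = e p p *+ 2.
Proof. by rewrite jordan_bracket !e_rel !relE. Qed.

Lemma jordan_weight_right :
  jordan (bracket (e p q) (e q p)) (e q q) = - (e q q *+ 2).
Proof. by rewrite jordan_bracket !e_rel !relE -mulNrn. Qed.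

(** The matrix [E_pp E_qq + E_qq E_pp] is zero, so this anticommutator
    commutes with every generator, in particular with [e_pq] and [e_qp]. *)
Lemma jordan_diag_central :
  bracket (bracket (e p q) (e q p)) (jordan (e p p) (e q q)) = 0.
Proof.
have zb : bracket (jordan (e p p) (e q q)) (e p q) = 0.
  by rewrite bracket_jordan !e_rel !relE.
have zc : bracket (jordan (e p p) (e q q)) (e q p) = 0.
  by rewrite bracket_jordan !e_rel !relE.
rewrite bracketC /(bracket (e p q)) bracketD bracketN !bracketM zb zc.
by rewrite !(mul0r, mulr0, addr0, subr0, oppr0).
Qed.

End TwoIndices.

(** The products [e_pp e_qq] and [e_qq e_pp] have opposite weights under
    [k = [e_pq, e_qp]], but their sum has weight zero. *)
Lemma diag_mul0 p q : p != q -> e p p * e q q = 0.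
Proof.
move=> pq; have qp : q != p by rewrite eq_sym.
set a := e p p; set d := e q q.
have kad := jordan_eigen (jordan_weight_left pq) (jordan_weight_right pq).
(* Exchanging p and q replaces k by - k, whence the weight -4 of d * a. *)
have := jordan_eigen (jordan_weight_left qp) (jordan_weight_right qp).
rewrite [bracket (e q p) _]bracketC bracketNl => /(canRL opprK) kda.
have := jordan_diag_central pq.
rewrite [jordan _ _]/jordan bracketD kad kda => /subr0_eq adda4.
have adda : a * d = d * a.
  apply/eqP; rewrite -subr_eq0; apply/eqP.
  do 2!apply: two_regular; rewrite -mulrnA mulrnBl; apply/eqP.
  by rewrite subr_eq0; apply/eqP.
have {}kda : bracket (bracket (e p q) (e q p)) (a * d) = - (a * d *+ 4).
  by rewrite adda.
do 3!apply: two_regular; rewrite -!mulrnA [LHS](mulrnDr _ 4 4).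
by rewrite -{1}kad kda addNr.
Qed.

(** * Identities with two indices *)

Section TwoIndexIdentities.
Variables p q : I.
Hypothesis pq : p != q.

Notation a := (e p p).
Notation b := (e p q).
Notation c := (e q p).
Notation d := (e q q).

Let qp : q != p. Proof. by rewrite eq_sym. Qed.
Let relE := (eqxx, negPf pq, negPf qp,
  andbT, andbF, mulr0n, mulr1n, subr0, sub0r, addr0, add0r).

(** This is the derivative of [a * d = 0] along [E_pq]. *)
Lemma diag_row : a * b = b * d.
Proof.
have := bracketM (jordan a b) a d.
rewrite diag_mul0 // bracket0 !bracket_unit // !relE mulNr addrC.
by move/esym/subr0_eq.
Qed.

(** This is the derivative of [a * d = 0] along [E_qp]. *)
Lemma diag_col : a * c = c * d.
Proof.
have := bracketM (jordan d c) a d.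
rewrite diag_mul0 // bracket0 !bracket_unit // !relE mulrN.
by move/esym/subr0_eq/esym.
Qed.

Lemma diag_row_diag0 : a * b * a = 0.
Proof. by rewrite diag_row -mulrA diag_mul0 ?mulr0. Qed.

Lemma diag_col_diag0 : a * c * a = 0.
Proof. by rewrite diag_col -mulrA diag_mul0 ?mulr0. Qed.

Lemma diag2_row : a * a * b = b * a * a + b.
Proof. by rewrite addrC -[LHS](subrK (b * a * a)) e_rel !relE. Qed.

Lemma diag2_col : a * a * c = c * a * a - c.
Proof. by rewrite addrC -[LHS](subrK (c * a * a)) e_rel !relE. Qed.

Lemma diag3_row : a * a * a * b = a * b.
Proof.
rewrite -2!mulrA [a * (a * b)]mulrA diag2_row mulrDr !mulrA.
by rewrite diag_row_diag0 mul0r add0r.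
Qed.

Lemma diag3_col : a * a * a * c = - (a * c).
Proof.
rewrite -2!mulrA [a * (a * c)]mulrA diag2_col mulrBr !mulrA.
by rewrite diag_col_diag0 mul0r sub0r.
Qed.

Lemma diag_row_expansion : a = a * b * c - c * b * a.
Proof. by rewrite e_rel !relE. Qed.

Lemma diag_col_expansion : a = b * c * a - a * c * b.
Proof. by rewrite e_rel !relE. Qed.

(** Left multiplication by [a ^+ 2] fixes [a * b * c] and negates
    [c * b * a], the correction term containing [a * b * a = 0]. *)
Lemma diag2_col_row_diag : a * a * c * b * a = - (c * b * a).
Proof.
rewrite diag2_col !mulrBl.
have -> : c * a * a * b * a = c * a * (a * b * a) by rewrite !mulrA.
by rewrite diag_row_diag0 mulr0 sub0r.
Qed.

Lemma diag_cube : a * a * a = a * b * c + c * b * a.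
Proof.
rewrite [X in _ * X = _]diag_row_expansion mulrBr !mulrA diag3_row.
by rewrite diag2_col_row_diag opprK.
Qed.

Lemma diag_pow5 : a ^+ 5 = a.
Proof.
have -> : a ^+ 5 = a * a * (a * a * a) by rewrite !exprS expr0 mulr1 !mulrA.
rewrite diag_cube mulrDr !mulrA diag3_row diag2_col_row_diag.
by rewrite -diag_row_expansion.
Qed.

Lemma diag_row_col_double : (a * b * c) *+ 2 = a ^+ 3 + a.
Proof.
have -> : a ^+ 3 = a * a * a by rewrite !exprS expr0 mulr1 !mulrA.
rewrite diag_cube [X in _ + X]diag_row_expansion.
by rewrite addrACA subrr addr0 mulr2n.
Qed.

(** Here left multiplication by [a ^+ 2] fixes [b * c * a] and negates
    [a * c * b], which gives [a ^+ 3 = b * c * a + a * c * b]. *)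
Lemma diag_col_row_double : (a * c * b) *+ 2 = a ^+ 3 - a.
Proof.
have -> : a ^+ 3 = a * a * a by rewrite !exprS expr0 mulr1 !mulrA.
rewrite [X in _ * X - _]diag_col_expansion mulrBr !mulrA.
rewrite diag3_col diag2_row !mulrDl.
have -> : b * a * a * c * a = b * a * (a * c * a) by rewrite !mulrA.
rewrite diag_col_diag0 mulr0 add0r mulNr opprK.
by rewrite [X in _ - X]diag_col_expansion opprB addrC addrA subrK mulr2n.
Qed.

End TwoIndexIdentities.

(** * Identities with three indices *)

(** For [i] and [j] distinct, this is the derivative of
    [e_pp * e_jj = 0] along [E_ij]. *)
Lemma diag_offdiag_mul0 p i j : i != p -> j != p -> e p p * e i j = 0.
Proof.
move=> ip jp; case: (eqVneq i j) => [<-|ij]; first by rewrite diag_mul0 // eq_sym.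
have := bracketM (jordan (e i i) (e i j)) (e p p) (e j j).
rewrite diag_mul0 1?eq_sym // bracket0 !bracket_unit //.
by rewrite (negPf jp) eqxx ![p == _]eq_sym (negPf ip) [j == i]eq_sym (negPf ij)
  !(mulr0n, mulr1n, subr0, sub0r, mul0r, mulNr, add0r, addr0).
Qed.

Lemma bracket_half (u x y : R) : x *+ 2 = y -> bracket u y = 0 -> bracket u x = 0.
Proof. by rewrite mulr2n => <-; rewrite bracketD -mulr2n => /two_regular. Qed.

(** By [diag_row_col_double], [e_pp * e_pi * e_ip] is half a polynomial in
    [e_pp], so it is killed by [ad E_ji], as [E_ji] commutes with [E_pp]; but
    among the three factors that derivation moves only the last one, sending
    [e_ip] to [e_jp]. *)
Lemma diag_row_col_mul0 p i j : i != p -> j != p -> i != j ->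
  e p p * e p i * e j p = 0.
Proof.
move=> ip jp ij; have ji : j != i by rewrite eq_sym.
pose u := jordan (e j j) (e j i).
have ua : bracket u (e p p) = 0.
  by rewrite bracket_unit // (negPf ip) [p == j]eq_sym (negPf jp) subrr.
have ub : bracket u (e p i) = 0.
  by rewrite bracket_unit // (negPf ip) (negPf ij) subrr.
have uc : bracket u (e i p) = e j p.
  by rewrite bracket_unit // eqxx [p == j]eq_sym (negPf jp) subr0.
have pi : p != i by rewrite eq_sym.
have := bracket_half (u := u) (diag_row_col_double pi).
rewrite bracketD ua !exprS expr0 mulr1 !bracketM ua ub uc.
by rewrite !(mul0r, mulr0, add0r, addr0) => /(_ erefl).
Qed.

(** The same argument with [ad E_ij], which sends the last factor [e_pi] of
    [e_pp * e_ip * e_pi] to [- e_pj]. *)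
Lemma diag_col_row_mul0 p i j : i != p -> j != p -> i != j ->
  e p p * e i p * e p j = 0.
Proof.
move=> ip jp ij; have ji : j != i by rewrite eq_sym.
pose u := jordan (e i i) (e i j).
have ua : bracket u (e p p) = 0.
  by rewrite bracket_unit // (negPf jp) [p == i]eq_sym (negPf ip) subrr.
have uc : bracket u (e i p) = 0.
  by rewrite bracket_unit // (negPf ji) [p == i]eq_sym (negPf ip) subrr.
have ub : bracket u (e p i) = - e p j.
  by rewrite bracket_unit // (negPf jp) eqxx sub0r.
have pi : p != i by rewrite eq_sym.
have := bracket_half (u := u) (diag_col_row_double pi).
rewrite bracketD bracketN ua !exprS expr0 mulr1 !bracketM ua ub uc mulrN.
rewrite !(mul0r, mulr0, add0r, addr0, oppr0) => /(_ erefl)/eqP.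
by rewrite oppr_eq0 => /eqP.
Qed.

End Representation.

(** * Multiplication by the fourth power of a diagonal generator *)

Lemma lmod_two_regular (F : fieldType) (V : lmodType F) (x : V) :
  2%:R != 0 :> F -> x *+ 2 = 0 -> x = 0.
Proof.
by move=> two0 /eqP; rewrite -scaler_nat scaler_eq0 (negPf two0) => /eqP.
Qed.

Lemma lmod_halve (F : fieldType) (V : lmodType F) (x y : V) :
  2%:R != 0 :> F -> x *+ 2 = y -> x = 2%:R^-1 *: y.
Proof. by move=> two0 <-; rewrite -scaler_nat scalerA mulVf ?scale1r. Qed.

Section FourthPower.
Variables (F : fieldType) (A : algType F) (I : eqType) (e : I -> I -> A).
Hypothesis two_neq0 : 2%:R != 0 :> F.
Hypothesis e_rel : forall i j k l m t,
  e i j * e k l * e m t - e m t * e k l * e i j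
  = e i t *+ ((j == k) && (l == m)) - e m j *+ ((t == k) && (l == i)).

Variables o o' : I.
Hypothesis oo' : o != o'.

Let reg (x : A) : x *+ 2 = 0 -> x = 0 := lmod_two_regular two_neq0.
Notation a := (e o o).

Let pow4M x : a ^+ 4 * x = a ^+ 3 * (a * x).
Proof. by rewrite exprSr mulrA. Qed.

Lemma pow4_powM m x : a ^+ 4 * (a ^+ m.+1 * x) = a ^+ m.+1 * x.
Proof. by rewrite (exprS a m) -mulrA [LHS]mulrA -exprSr (diag_pow5 reg e_rel oo'). Qed.

Lemma pow4_pow m : a ^+ 4 * a ^+ m.+1 = a ^+ m.+1.
Proof. by rewrite -[a ^+ m.+1]mulr1 pow4_powM. Qed.

Let scaleE := (subrr, subr0, mul0r, mulr0, mul1r, scale0r, scale1r, addr0, add0r).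

Lemma pow4_unit i j :
  a ^+ 4 * e i j
  = kd F i o *: (kd F j o *: a + kdhat F j o *: (a ^+ 2 * e o j))
    - (kdhat F i o * kd F j o) *: (a ^+ 2 * e i o).
Proof.
rewrite /kdhat /kd; case: (eqVneq i o) => [->|io]; case: (eqVneq j o) => [->|jo];
  rewrite !scaleE.
- exact: pow4_pow 0.
- rewrite exprS -mulrA.
  have -> : a ^+ 3 = a * a * a by rewrite !exprS expr0 mulr1 !mulrA.
  by rewrite (diag3_row reg e_rel) 1?eq_sym // mulrA.
- rewrite exprS -mulrA.
  have -> : a ^+ 3 = a * a * a by rewrite !exprS expr0 mulr1 !mulrA.
  by rewrite (diag3_col reg e_rel) 1?eq_sym // mulrN mulrA.
- by rewrite pow4M (diag_offdiag_mul0 reg e_rel) // mulr0 oppr0.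
Qed.

Lemma pow4_row_col i j : (i, j) <> (o, o) ->
  a ^+ 4 * (e o i * e j o)
  = kd F i o *: (a * e j o)
    + (kdhat F i o * kdhat F j o * kd F i j * 2%:R^-1) *: (a ^+ 4 + a ^+ 2).
Proof.
rewrite /kdhat /kd; case: (eqVneq i o) => [->|io]; case: (eqVneq j o) => [->|jo] ij;
  rewrite !scaleE.
- by case: ij.
- exact: (pow4_powM 0).
- by rewrite pow4M [a * _]mulrA (diag_row_diag0 reg e_rel) 1?eq_sym ?mulr0.
rewrite pow4M [a * _]mulrA; case: (eqVneq i j) => [<-|{}ij].
  have oi : o != i by rewrite eq_sym.
  have -> := lmod_halve two_neq0 (diag_row_col_double reg e_rel oi).
  by rewrite mul1r -scalerAr mulrDr -exprSr addrC -(pow4_pow 1) -!exprD.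
by rewrite mul0r scale0r (diag_row_col_mul0 reg e_rel) // mulr0.
Qed.

Lemma pow4_col_row i j :
  a ^+ 4 * (e i o * e o j)
  = kd F i o *: (a * e o j)
    + (kdhat F i o * kd F i j * 2%:R^-1) *: (a ^+ 2 - a ^+ 4).
Proof.
rewrite /kdhat /kd; case: (eqVneq i o) => [->|io]; rewrite !scaleE.
  exact: (pow4_powM 0).
rewrite pow4M [a * _]mulrA; case: (eqVneq j o) => [->|jo].
  rewrite (negPf io) mul0r scale0r.
  by rewrite (diag_col_diag0 reg e_rel) 1?eq_sym ?mulr0.
case: (eqVneq i j) => [<-|ij].
  have oi : o != i by rewrite eq_sym.
  have -> := lmod_halve two_neq0 (diag_col_row_double reg e_rel oi).
  by rewrite mul1r -scalerAr mulrBr -exprSr -(pow4_pow 1) -!exprD.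
by rewrite mul0r scale0r (diag_col_row_mul0 reg e_rel) // mulr0.
Qed.

Lemma pow4_row_diag_col i j :
  a ^+ 4 * (e o i * a * e j o) = kd F i o *: (a ^+ 2 * e j o).
Proof.
rewrite /kd; case: (eqVneq i o) => [->|io]; first by rewrite scale1r (pow4_powM 1).
rewrite scale0r pow4M [a * (_ * e j o)]mulrA [a * (_ * a)]mulrA.
by rewrite (diag_row_diag0 reg e_rel) 1?eq_sym // mul0r mulr0.
Qed.

End FourthPower.

(** * The universal associative envelope *)

Lemma env_e_triple (F : fieldType) (n : nat) (i j k l m t : 'I_n) :
  @env_e F n i j * env_e F k l * env_e F m t
  - env_e F m t * env_e F k l * env_e F i j
  = env_e F i t *+ ((j == k) && (l == m)) - env_e F m j *+ ((t == k) && (l == i)).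
Proof.
apply/eqP; rewrite -subr_eq0 opprB addrA -(env_e_rel F i j k l m t).
by rewrite /kd -!natrM !mulnb !scaler_nat -!addrA [_ *+ _ + - _]addrC.
Qed.

Unset Implicit Arguments.

Theorem proposition4p8 (F : closedFieldType) (charF0 : [pchar F] =i pred0)
    (n : nat) (n_ge2 : (2 <= n)%N) :
  let o : 'I_n := Ordinal (ltnW n_ge2) in
  let e : 'I_n -> 'I_n -> envelope F n := @env_e F n in
  forall i j : 'I_n,
  (* (1) *)
  (e o o ^+ 4 * e i j
   = kd F i o *: (kd F j o *: e o o + kdhat F j o *: (e o o ^+ 2 * e o j))
     - (kdhat F i o * kd F j o) *: (e o o ^+ 2 * e i o))
  /\
  (* (2) *)
  ((i, j) <> (o, o) ->
   e o o ^+ 4 * (e o i * e j o)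
   = kd F i o *: (e o o * e j o)
     + (kdhat F i o * kdhat F j o * kd F i j * 2%:R^-1)
         *: (e o o ^+ 4 + e o o ^+ 2))
  /\
  (* (3) *)
  (e o o ^+ 4 * (e i o * e o j)
   = kd F i o *: (e o o * e o j)
     + (kdhat F i o * kd F i j * 2%:R^-1) *: (e o o ^+ 2 - e o o ^+ 4))
  /\
  (* (4) *)
  (e o o ^+ 4 * (e o o ^+ 2 * e o j) = e o o ^+ 2 * e o j)
  /\
  (* (5) *)
  (j <> o ->
   e o o ^+ 4 * (e o i * e o o * e j o) = kd F i o *: (e o o ^+ 2 * e j o))
  /\
  (* (6) *)
  (e o o ^+ 4 * e o o ^+ 4 = e o o ^+ 4).
Proof.
move=> o e i j.
have two0 : 2%:R != 0 :> F by move/negbT: (charF0 2%N); rewrite inE.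
have rel := @env_e_triple F n.
have oo' : o != Ordinal n_ge2 by [].
split; first exact: (pow4_unit two0 rel oo').
split; first exact: (pow4_row_col two0 rel oo').
split; first exact: (pow4_col_row two0 rel oo').
split; first exact: (pow4_powM two0 rel oo' 1).
split; first by move=> _; exact: (pow4_row_diag_col two0 rel oo').
exact: (pow4_pow two0 rel oo' 3).
Qed.
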